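(* Let $q\in\{1,-1\}$. The homogeneous averaging operators $P_0^1,\dots,P_0^5$ with degree $0$ (those operators of the forms listed in the context that are averaging operators) on the $q$-deformed $W(2,2)$ Hom-algebra $\mathcal{W}^q$ provide, via $\{x,y\}^i=[P_0^i(x),y]$, the following Hom-Leibniz algebras $(\mathcal{W}^q,\{\cdot,\cdot\}^i,\alpha)$ on the underlying linear space $\mathcal{W}^q$: for all $m,n\in\mathbb{Z}$, writing $\delta=\delta_{m,0}$, (i) $\{L_m,L_n\}^1=\nu_1\delta[m-n]L_{m+n}+(\nu_3\delta+\gamma)[m-n]W_{m+n}$, $\{L_m,W_n\}^1=\nu_1\delta[m-n]W_{m+n}$, $\{W_m,L_n\}^1=\nu_2\delta[m-n]L_{m+n}+\nu_4\delta[m-n]W_{m+n}$, $\{W_m,W_n\}^1=\nu_2\delta[m-n]W_{m+n}$; (ii) $\{L_m,L_n\}^2=(\nu_1\delta+\beta)[m-n]L_{m+n}+(\nu_3\delta+\gamma)[m-n]W_{m+n}$, $\{L_m,W_n\}^2=(\nu_1\delta+\beta)[m-n]W_{m+n}$, $\{W_m,L_n\}^2=\nu_2\delta[m-n]L_{m+n}+\nu_4\delta[m-n]W_{m+n}$, $\{W_m,W_n\}^2=\nu_2\delta[m-n]W_{m+n}$; (iii) $\{L_m,L_n\}^3=(\nu_1\delta+\beta)[m-n]L_{m+n}+\nu_3\delta[m-n]W_{m+n}$, $\{L_m,W_n\}^3=(\nu_1\delta+\beta)[m-n]W_{m+n}$, $\{W_m,L_n\}^3=\nu_2\delta[m-n]L_{m+n}+(\nu_4\delta+\beta)[m-n]W_{m+n}$,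 $\{W_m,W_n\}^3=\nu_2\delta[m-n]W_{m+n}$; (iv) $\{L_m,L_n\}^4=(\nu_1\delta+\gamma)[m-n]L_{m+n}+\nu_3\delta[m-n]W_{m+n}$, $\{L_m,W_n\}^4=(\nu_1\delta+\gamma)[m-n]W_{m+n}$, $\{W_m,L_n\}^4=\nu_2\delta[m-n]L_{m+n}+(\nu_4\delta+\beta)[m-n]W_{m+n}$, $\{W_m,W_n\}^4=\nu_2\delta[m-n]W_{m+n}$; (v) $\{L_m,L_n\}^5=(\nu_1\delta+\gamma)[m-n]L_{m+n}+\big(\nu_3\delta+\frac{\gamma\theta-\gamma^2}{\beta}\big)[m-n]W_{m+n}$, $\{L_m,W_n\}^5=(\nu_1\delta+\gamma)[m-n]W_{m+n}$, $\{W_m,L_n\}^5=(\nu_2\delta+\beta)[m-n]L_{m+n}+(\nu_4\delta+\theta-\gamma)[m-n]W_{m+n}$, $\{W_m,W_n\}^5=(\nu_2\delta+\beta)[m-n]W_{m+n}$; where $\nu_1,\nu_2,\nu_3,\nu_4,\gamma,\theta\in\mathbb{K}$ and $\beta\in\mathbb{K}\setminus\{0\}$.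
   Context: $\mathbb{K}$ is a field of characteristic zero. For $n\in\mathbb{Z}$ put $[n]=n$ if $q=1$ and $[n]=(-1)^{n-1}n$ if $q=-1$. The $q$-deformed $W(2,2)$ Hom-algebra $(\mathcal{W}^q,[\cdot,\cdot],\alpha)$ is the $\mathbb{K}$-vector space with basis $\{L_n,W_n\mid n\in\mathbb{Z}\}$, with the skew-symmetric bilinear product determined by $[L_m,L_n]=[m-n]L_{m+n}$, $[L_m,W_n]=[m-n]W_{m+n}$, $[W_m,W_n]=0$, and with the linear map $\alpha(L_n)=(q^n+q^{-n})L_n$, $\alpha(W_n)=(q^n+q^{-n})W_n$. It is $\mathbb{Z}$-graded with $\mathcal{W}^q_n=\mathrm{span}_{\mathbb{K}}\{L_n,W_n\}$. An averaging operator on a Hom-algebra $(A,[\cdot,\cdot],\alpha)$ (a vector space with a bilinear product and a linear map $\alpha:A\to A$) is a linear map $P:A\to A$ with $\alpha\circ P=P\circ\alpha$ and $[P(x),P(y)]=P([P(x),y])=P([x,P(y)])$ for all $x,y\in A$. It is homogeneous with degree $d$ if $P(\mathcal{W}^q_m)\subseteq\mathcal{W}^q_{m+d}$ for all $m\in\mathbb{Z}$. A Hom-Leibniz algebra is a Hom-algebra $(A,\{\cdot,\cdot\},\alpha)$ with $\{\alpha(x),\{y,z\}\}=\{\{x,y\},\alpha(z)\}+\{\alpha(y),\{x,z\}\}$ for all $x,y,z\in A$. $\delta_{m,0}=1$ if $m=0$ and $0$ otherwise. The operators are, for all $m\in\mathbb{Z}$, with $\delta=\delta_{m,0}$: $P_0^1(L_m)=\nu_1\delta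 L_{m}+(\nu_3\delta+\gamma)W_{m}$, $P_0^1(W_m)=\nu_2\delta L_{m}+\nu_4\delta W_{m}$; $P_0^2(L_m)=(\nu_1\delta+\beta)L_{m}+(\nu_3\delta+\gamma)W_{m}$, $P_0^2(W_m)=\nu_2\delta L_{m}+\nu_4\delta W_{m}$; $P_0^3(L_m)=(\nu_1\delta+\beta)L_{m}+\nu_3\delta W_{m}$, $P_0^3(W_m)=\nu_2\delta L_{m}+(\nu_4\delta+\beta)W_{m}$; $P_0^4(L_m)=(\nu_1\delta+\gamma)L_{m}+\nu_3\delta W_{m}$, $P_0^4(W_m)=\nu_2\delta L_{m}+(\nu_4\delta+\beta)W_{m}$; $P_0^5(L_m)=(\nu_1\delta+\gamma)L_{m}+\big(\nu_3\delta+\frac{\gamma\theta-\gamma^2}{\beta}\big)W_{m}$, $P_0^5(W_m)=(\nu_2\delta+\beta)L_{m}+(\nu_4\delta+\theta-\gamma)W_{m}$; with $\nu_1,\dots,\nu_4,\gamma,\theta\in\mathbb{K}$, $\beta\in\mathbb{K}\setminus\{0\}$. *)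

(* Defs.v *)
From HB Require Import structures.
From mathcomp Require Import all_boot all_order all_algebra.
From mathcomp Require Import freeg.

Set Implicit Arguments.
Unset Strict Implicit.
Unset Printing Implicit Defensive.

Import GRing.Theory.

Local Open Scope ring_scope.

Section HomAlgebras.

Variables (K : fieldType) (A : lmodType K).
Implicit Types (mul : A -> A -> A) (alpha P : A -> A).

Definition hom_algebra mul alpha : Prop :=
  [/\ forall x, linear (mul x), forall y, linear (mul^~ y) & linear alpha].

Definition hom_leibniz_algebra mul alpha : Prop :=
  hom_algebra mul alpha /\
  forall x y z,
    mul (alpha x) (mul y z) = mul (mul x y) (alpha z) + mul (alpha y) (mul x z).

Definition averaging_operator mul alpha P : Prop :=
  [/\ linear P,
      forall x, alpha (P x) = P (alpha x),
      forall x y, mul (P x) (P y) = P (mul (P x) y)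
    & forall x y, mul (P x) (P y) = P (mul x (P y))].

Definition derived_product mul P : A -> A -> A := fun x y => mul (P x) y.

End HomAlgebras.

(* [n] for q in {1, -1}; the value at any other q is irrelevant. *)
Definition qint (K : fieldType) (q : K) (n : int) : K :=
  if q == 1 then n%:~R else (-1) ^ (n - 1) * n%:~R.

(* The space with basis {L_n, W_n | n in Z}: inl n indexes L_n, inr n indexes
   W_n. A function on indices extends linearly by fglift. *)
Notation W22 K := {freeg (int + int)%type / K}.

Section W22.

Variable K : fieldType.
Implicit Types (q : K) (m n d : int).

Definition Lb n : W22 K := << (inl n : int + int) >>.
Definition Wb n : W22 K := << (inr n : int + int) >>.

(* The case [W_m, L_n] is - [L_n, W_m], by skew-symmetry. *)
Definition W22_basis_bracket q (i j : int + int) : W22 K :=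
  match i, j with
  | inl m, inl n => qint q (m - n) *: Lb (m + n)
  | inl m, inr n => qint q (m - n) *: Wb (m + n)
  | inr m, inl n => - (qint q (n - m) *: Wb (n + m))
  | inr _, inr _ => 0
  end.

Definition W22_bracket q (x y : W22 K) : W22 K :=
  fglift (fun i => fglift (W22_basis_bracket q i) y) x.

Definition W22_alpha q : W22 K -> W22 K :=
  fglift (fun i => match i with
                   | inl n => (q ^ n + q ^ (- n)) *: Lb n
                   | inr n => (q ^ n + q ^ (- n)) *: Wb n
                   end).

Definition W22_component n (x : W22 K) : Prop :=
  exists a b : K, x = a *: Lb n + b *: Wb n.

Definition homogeneous_operator d (P : W22 K -> W22 K) : Prop :=
  forall m x, W22_component m x -> W22_component (m + d) (P x).

Definition homogeneous_averaging_operator q d (P : W22 K -> W22 K) : Prop :=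
  averaging_operator (W22_bracket q) (W22_alpha q) P /\
  homogeneous_operator d P.

Definition delta0 m : K := (m == 0)%:R.

(* The linear operator with L_m |-> PL m and W_m |-> PW m. *)
Definition operator_on_basis (PL PW : int -> W22 K) : W22 K -> W22 K :=
  fglift (fun i => match i with inl m => PL m | inr m => PW m end).

Definition P01 (nu1 nu2 nu3 nu4 gamma : K) :=
  operator_on_basis
    (fun m => (nu1 * delta0 m) *: Lb m + (nu3 * delta0 m + gamma) *: Wb m)
    (fun m => (nu2 * delta0 m) *: Lb m + (nu4 * delta0 m) *: Wb m).

Definition P02 (nu1 nu2 nu3 nu4 beta gamma : K) :=
  operator_on_basis
    (fun m => (nu1 * delta0 m + beta) *: Lb m
              + (nu3 * delta0 m + gamma) *: Wb m)
    (fun m => (nu2 * delta0 m) *: Lb m + (nu4 * delta0 m) *: Wb m).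

Definition P03 (nu1 nu2 nu3 nu4 beta : K) :=
  operator_on_basis
    (fun m => (nu1 * delta0 m + beta) *: Lb m + (nu3 * delta0 m) *: Wb m)
    (fun m => (nu2 * delta0 m) *: Lb m + (nu4 * delta0 m + beta) *: Wb m).

Definition P04 (nu1 nu2 nu3 nu4 beta gamma : K) :=
  operator_on_basis
    (fun m => (nu1 * delta0 m + gamma) *: Lb m + (nu3 * delta0 m) *: Wb m)
    (fun m => (nu2 * delta0 m) *: Lb m + (nu4 * delta0 m + beta) *: Wb m).

Definition P05 (nu1 nu2 nu3 nu4 beta gamma theta : K) :=
  operator_on_basis
    (fun m => (nu1 * delta0 m + gamma) *: Lb m
              + (nu3 * delta0 m + (gamma * theta - gamma ^+ 2) / beta) *: Wb m)
    (fun m => (nu2 * delta0 m + beta) *: Lb m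
              + (nu4 * delta0 m + theta - gamma) *: Wb m).

End W22.

Arguments Lb {K} n.
Arguments Wb {K} n.
Arguments delta0 {K} m.

(* Main.v *)
Require Import Defs.
From HB Require Import structures.
From mathcomp Require Import all_boot all_order all_algebra.
From mathcomp Require Import freeg.
From mathcomp Require Import ring.

Set Implicit Arguments.
Unset Strict Implicit.
Unset Printing Implicit Defensive.

Import GRing.Theory.

Local Open Scope ring_scope.

(** If [P] is an averaging operator on [A] and [{x, y} = [P x, y]], then both
    sides of the Hom-Leibniz identity for [{.,.}] are the two sides of the
    Hom-Leibniz identity of [A] itself, taken at [P x], [P y] and [z]: the
    operator [P] commutes with [alpha], and [P] of the bracket of [P x] and [y]
    is the bracket of [P x] and [P y].  Hence deriving along an averaging
    operator preserves Hom-Leibniz algebras ([derived_hom_leibniz]), and it remains to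
    see that [W^q] is one ([W22_hom_leibniz]).

    On basis elements all the nonzero cases of that identity are one and the
    same identity between scalars ([qint_jacobi]).  Since [q = 1] or [q = -1],
    we have [[n] = q ^ (n - 1) * n] and [q ^ n + q ^ (- n) = 2 * q ^ n]; each of
    the three terms is then twice the corresponding term of the Jacobi identity
    of the Witt algebra, as all the powers of [q] pair up to squares, which are
    equal to 1.

    The five multiplication tables are instances of a single computation, in
    which the coefficients of the operator on [L_m] and [W_m] are arbitrary
    functions of [m] ([derived_on_basis]). *)

(** * Linear extension from a basis *)

Section LinearExtension.

Variables (K : fieldType) (I : choiceType) (M : lmodType K).
Implicit Types (f : I -> M) (D : {freeg I / K}).

Lemma additive_fglift f : {morph fglift f : D E / D + E}.
Proof.
have fB := lift_is_additive f.
have f0 : fglift f 0 = 0 by rewrite -(subrr 0) fB subrr.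
by move=> D E; rewrite -[E in LHS]opprK -[- E]sub0r !fB f0 sub0r opprK.
Qed.

Lemma fglift_sum f (J : Type) (s : seq J) (F : J -> {freeg I / K}) :
  fglift f (\sum_(j <- s) F j) = \sum_(j <- s) fglift f (F j).
Proof.
apply: (big_morph _ (additive_fglift f)).
by rewrite -(subrr 0) lift_is_additive subrr.
Qed.

Lemma fgliftE f D : fglift f D = \sum_(i <- dom D) coeff i D *: f i.
Proof.
rewrite -[D in LHS]freeg_sumE fglift_sum.
by apply: eq_bigr => i _; rewrite liftU.
Qed.

Lemma fglift_linear f : linear (fglift f).
Proof.
move=> a D E; rewrite additive_fglift; congr (_ + _).
rewrite [a *: D]/(fgscale a D) /fgscale fglift_sum fgliftE scaler_sumr.
by apply: eq_bigr => i _; rewrite liftU scalerA.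
Qed.

Lemma fglift_basis f i : fglift f << i >> = f i.
Proof. by rewrite liftU scale1r. Qed.

End LinearExtension.

(** Multilinear identities are checked on a basis by using this principle once
    for each variable. The index [i0] only serves to reach 0, as
    [- << i0 >> + << i0 >>]. *)
Lemma freeg_linear_ind (K : fieldType) (I : choiceType) (i0 : I)
    (Q : {freeg I / K} -> Prop) :
  (forall i, Q << i >>) ->
  (forall a D E, Q D -> Q E -> Q (a *: D + E)) -> forall D, Q D.
Proof.
move=> Qbasis Qlin; elim/freeg_ind_dom0 => [|k i D _ _ QD].
  by rewrite -(addNr << i0 >>) -scaleN1r; apply: Qlin.
have -> : << k *g i >> = k *: << i >> :> {freeg I / K}.
  by apply/eqP/freeg_eqP => j; rewrite coeffZ !coeffU mul1r.
exact: Qlin.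
Qed.

(** * Deriving along an averaging operator *)

(** Commuting [P] with [alpha] and writing [mul (P x) (P y)] for
    [P (mul (P x) y)] turns the identity for the derived product at [x], [y],
    [z] into the identity for [mul] at [P x], [P y], [z]. *)
Lemma derived_hom_leibniz (K : fieldType) (A : lmodType K)
    (mul : A -> A -> A) (alpha P : A -> A) :
  hom_leibniz_algebra mul alpha -> averaging_operator mul alpha P ->
  hom_leibniz_algebra (derived_product mul P) alpha.
Proof.
move=> [[mulr mull alphal] leib] [Pl Palpha Pavl _]; split; last first.
  by move=> x y z; rewrite /derived_product -!Palpha leib -Pavl.
split=> // [x|y a x x']; rewrite /derived_product; first exact: mulr.
by rewrite Pl mull.
Qed.

(** * The q-deformed W(2,2) Hom-algebra *)

Section W22.

Variables (K : fieldType) (q : K).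
Hypothesis hq : q = 1 \/ q = -1.
Implicit Types (m n p : int) (x y z : W22 K).

Local Notation "[[ x , y ]]" := (W22_bracket q x y).
Local Notation "[ n ]q" := (qint q n).
Local Notation alpha := (W22_alpha q).

Lemma sqrq1 : q ^+ 2 = 1.
Proof. by case: hq => ->; rewrite ?sqrrN expr1n. Qed.

Lemma q_neq0 : q != 0.
Proof. by case: hq => ->; rewrite ?oppr_eq0 oner_neq0. Qed.

Lemma sqr_exprz m : (q ^ m) ^+ 2 = 1.
Proof. by rewrite exprnP exprzAC -exprnP sqrq1 exp1rz. Qed.

Lemma exprzN_q m : q ^ (- m) = q ^ m.
Proof. by rewrite -exprz_inv; case: hq => ->; rewrite ?invrN invr1. Qed.

Lemma qintE n : [n]q = q ^ n * q * n%:~R.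
Proof.
have -> : q ^ n * q = q ^ (n - 1) by rewrite expfzDr ?q_neq0 // exprzN_q expr1z.
rewrite /qint; case: eqP => [->|q1]; first by rewrite exp1rz mul1r.
by case: hq => [/q1|->].
Qed.

Lemma qintN n : [- n]q = - [n]q.
Proof. by rewrite !qintE exprzN_q rmorphN mulrN. Qed.

(** Hom-Jacobi identity for the structure constants; moving all the powers of
    [q] together, [q ^+ 2 = (q ^ m) ^+ 2 = 1] leaves twice the identity
    [(n - p) (m - n - p) = (m - n) (m + n - p) + (m - p) (n - m - p)]. *)
Lemma qint_jacobi m n p :
  (q ^ m + q ^ (- m)) * [n - p]q * [m - (n + p)]q =
  [m - n]q * (q ^ p + q ^ (- p)) * [m + n - p]q +
  (q ^ n + q ^ (- n)) * [m - p]q * [n - (m + p)]q.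
Proof.
rewrite !qintE !(expfzDr, exprzN_q, q_neq0) //.
have hm := sqr_exprz m; have hn := sqr_exprz n; have hp := sqr_exprz p.
have q2 := sqrq1.
rewrite !(intrD, rmorphN) /=.
move: (q ^ m) (q ^ n) (q ^ p) hm hn hp => u v w hm hn hp.
ring: hm hn hp q2.
Qed.

Lemma W22_bracket_linear_l y : linear (W22_bracket q ^~ y).
Proof. exact: fglift_linear. Qed.

Lemma W22_bracket_linear_r x : linear (W22_bracket q x).
Proof.
move=> a y y'; rewrite /W22_bracket !fgliftE scaler_sumr -big_split /=.
by apply: eq_bigr => i _; rewrite fglift_linear scalerDr scalerA mulrC -scalerA.
Qed.

Lemma W22_hom_algebra : hom_algebra (W22_bracket q) alpha.
Proof.
split; [exact: W22_bracket_linear_r | exact: W22_bracket_linear_l |].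
exact: fglift_linear.
Qed.

HB.instance Definition _ := GRing.isLinear.Build K (W22 K) (W22 K) *:%R alpha
  (fglift_linear _).
HB.instance Definition _ x := GRing.isLinear.Build K (W22 K) (W22 K) *:%R
  (W22_bracket q x) (W22_bracket_linear_r x).

Lemma W22_bracketDl x x' y : [[x + x', y]] = [[x, y]] + [[x', y]].
Proof. by rewrite -[x]scale1r W22_bracket_linear_l !scale1r. Qed.

Lemma W22_bracket0l y : [[0, y]] = 0.
Proof.
have := W22_bracket_linear_l y (-1) 0 0.
by rewrite scaler0 addr0 scaleN1r addNr.
Qed.

Lemma W22_bracketZl a x y : [[a *: x, y]] = a *: [[x, y]].
Proof. by rewrite -[a *: x]addr0 W22_bracket_linear_l W22_bracket0l addr0. Qed.

Lemma W22_bracketZr a x y : [[x, a *: y]] = a *: [[x, y]].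
Proof. exact: linearZ. Qed.

Lemma W22_bracketLL m n : [[Lb m, Lb n]] = [m - n]q *: Lb (m + n).
Proof. by rewrite /W22_bracket !fglift_basis. Qed.

Lemma W22_bracketLW m n : [[Lb m, Wb n]] = [m - n]q *: Wb (m + n).
Proof. by rewrite /W22_bracket !fglift_basis. Qed.

Lemma W22_bracketWL m n : [[Wb m, Lb n]] = [m - n]q *: Wb (m + n).
Proof.
by rewrite /W22_bracket !fglift_basis /= -scaleNr -qintN opprB [n + m]addrC.
Qed.

Lemma W22_bracketWW m n : [[Wb m, Wb n]] = 0.
Proof. by rewrite /W22_bracket !fglift_basis. Qed.

Lemma W22_alphaL n : alpha (Lb n) = (q ^ n + q ^ (- n)) *: Lb n.
Proof. exact: fglift_basis. Qed.

Lemma W22_alphaW n : alpha (Wb n) = (q ^ n + q ^ (- n)) *: Wb n.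
Proof. exact: fglift_basis. Qed.

Definition W22_basisE := (W22_alphaL, W22_alphaW, W22_bracketLL, W22_bracketLW,
  W22_bracketWL, W22_bracketWW).

Lemma W22_linear_ind (Q : W22 K -> Prop) :
  (forall a x y, Q x -> Q y -> Q (a *: x + y)) ->
  (forall m, Q (Lb m)) -> (forall m, Q (Wb m)) -> forall x, Q x.
Proof. by move=> Qlin QL QW; apply: (freeg_linear_ind (inl 0)) => // -[]. Qed.

Lemma W22_hom_leibniz : hom_leibniz_algebra (W22_bracket q) alpha.
Proof.
split; first exact: W22_hom_algebra.
move=> x y z; move: x.
apply: W22_linear_ind => [a x x' IH IH'|m|m].
1: by rewrite !(linearP, W22_bracketDl, W22_bracketZl) /= IH IH' scalerDr
  addrACA.
all: move: y; apply: W22_linear_ind => [a y y' IH IH'|n|n].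
1,4: by rewrite !(linearP, W22_bracketDl, W22_bracketZl) /= IH IH' scalerDr
  addrACA.
all: move: z; apply: W22_linear_ind => [a z z' IH IH'|p|p].
1,4,7,10: by rewrite !linearP /= IH IH' scalerDr addrACA.
(* Two or more W's annihilate every term; the other four cases are multiples of
   a single basis element. *)
all: rewrite !(W22_basisE, W22_bracketZl, W22_bracketZr, W22_bracket0l,
  linear0, scaler0, addr0, add0r) //.
all: rewrite !scalerA [n + (m + p)]addrCA -[m + n + p]addrA -scalerDl.
all: by rewrite -qint_jacobi.
Qed.

(** All five families send [L_m] and [W_m] to combinations of [L_m] and [W_m]; as
    the [W_n] commute with each other, the coefficients of [W_m] contribute only
    to brackets with the [L_n]. *)
Lemma derived_on_basis (a b c d : int -> K) :
  let P := operator_on_basis (fun m => a m *: Lb m + b m *: Wb m)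
                             (fun m => c m *: Lb m + d m *: Wb m) in
  let br := derived_product (W22_bracket q) P in
  averaging_operator (W22_bracket q) alpha P ->
  hom_leibniz_algebra br alpha /\
  forall m n,
  [/\ br (Lb m) (Lb n) =
        (a m * [m - n]q) *: Lb (m + n) + (b m * [m - n]q) *: Wb (m + n),
      br (Lb m) (Wb n) = (a m * [m - n]q) *: Wb (m + n),
      br (Wb m) (Lb n) =
        (c m * [m - n]q) *: Lb (m + n) + (d m * [m - n]q) *: Wb (m + n)
    & br (Wb m) (Wb n) = (c m * [m - n]q) *: Wb (m + n)].
Proof.
move=> P br avP; split; first exact: derived_hom_leibniz W22_hom_leibniz avP.
have PL m : P (Lb m) = a m *: Lb m + b m *: Wb m by exact: fglift_basis.
have PW m : P (Wb m) = c m *: Lb m + d m *: Wb m by exact: fglift_basis.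
by move=> m n; split; rewrite /br /derived_product ?PL ?PW W22_bracketDl
  !W22_bracketZl !W22_basisE ?scaler0 ?addr0 !scalerA.
Qed.

End W22.

Theorem theorem4p14 (K : fieldType) (hK : [pchar K] =i pred0)
    (q : K) (hq : q = 1 \/ q = -1)
    (nu1 nu2 nu3 nu4 gamma theta beta : K) (hbeta : beta != 0) :
  [/\ (let P := P01 nu1 nu2 nu3 nu4 gamma in
       let br := derived_product (W22_bracket q) P in
       homogeneous_averaging_operator q 0 P ->
       hom_leibniz_algebra br (W22_alpha q) /\
       forall m n : int,
       [/\ br (Lb m) (Lb n) =
             (nu1 * delta0 m * qint q (m - n)) *: Lb (m + n)
             + ((nu3 * delta0 m + gamma) * qint q (m - n)) *: Wb (m + n),
           br (Lb m) (Wb n) =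
             (nu1 * delta0 m * qint q (m - n)) *: Wb (m + n),
           br (Wb m) (Lb n) =
             (nu2 * delta0 m * qint q (m - n)) *: Lb (m + n)
             + (nu4 * delta0 m * qint q (m - n)) *: Wb (m + n)
         & br (Wb m) (Wb n) =
             (nu2 * delta0 m * qint q (m - n)) *: Wb (m + n)]),
      (let P := P02 nu1 nu2 nu3 nu4 beta gamma in
       let br := derived_product (W22_bracket q) P in
       homogeneous_averaging_operator q 0 P ->
       hom_leibniz_algebra br (W22_alpha q) /\
       forall m n : int,
       [/\ br (Lb m) (Lb n) =
             ((nu1 * delta0 m + beta) * qint q (m - n)) *: Lb (m + n)
             + ((nu3 * delta0 m + gamma) * qint q (m - n)) *: Wb (m + n),
           br (Lb m) (Wb n) =
             ((nu1 * delta0 m + beta) * qint q (m - n)) *: Wb (m + n),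
           br (Wb m) (Lb n) =
             (nu2 * delta0 m * qint q (m - n)) *: Lb (m + n)
             + (nu4 * delta0 m * qint q (m - n)) *: Wb (m + n)
         & br (Wb m) (Wb n) =
             (nu2 * delta0 m * qint q (m - n)) *: Wb (m + n)]),
      (let P := P03 nu1 nu2 nu3 nu4 beta in
       let br := derived_product (W22_bracket q) P in
       homogeneous_averaging_operator q 0 P ->
       hom_leibniz_algebra br (W22_alpha q) /\
       forall m n : int,
       [/\ br (Lb m) (Lb n) =
             ((nu1 * delta0 m + beta) * qint q (m - n)) *: Lb (m + n)
             + (nu3 * delta0 m * qint q (m - n)) *: Wb (m + n),
           br (Lb m) (Wb n) =
             ((nu1 * delta0 m + beta) * qint q (m - n)) *: Wb (m + n),
           br (Wb m) (Lb n) =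
             (nu2 * delta0 m * qint q (m - n)) *: Lb (m + n)
             + ((nu4 * delta0 m + beta) * qint q (m - n)) *: Wb (m + n)
         & br (Wb m) (Wb n) =
             (nu2 * delta0 m * qint q (m - n)) *: Wb (m + n)]),
      (let P := P04 nu1 nu2 nu3 nu4 beta gamma in
       let br := derived_product (W22_bracket q) P in
       homogeneous_averaging_operator q 0 P ->
       hom_leibniz_algebra br (W22_alpha q) /\
       forall m n : int,
       [/\ br (Lb m) (Lb n) =
             ((nu1 * delta0 m + gamma) * qint q (m - n)) *: Lb (m + n)
             + (nu3 * delta0 m * qint q (m - n)) *: Wb (m + n),
           br (Lb m) (Wb n) =
             ((nu1 * delta0 m + gamma) * qint q (m - n)) *: Wb (m + n),
           br (Wb m) (Lb n) =
             (nu2 * delta0 m * qint q (m - n)) *: Lb (m + n)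
             + ((nu4 * delta0 m + beta) * qint q (m - n)) *: Wb (m + n)
         & br (Wb m) (Wb n) =
             (nu2 * delta0 m * qint q (m - n)) *: Wb (m + n)])
    & (let P := P05 nu1 nu2 nu3 nu4 beta gamma theta in
       let br := derived_product (W22_bracket q) P in
       homogeneous_averaging_operator q 0 P ->
       hom_leibniz_algebra br (W22_alpha q) /\
       forall m n : int,
       [/\ br (Lb m) (Lb n) =
             ((nu1 * delta0 m + gamma) * qint q (m - n)) *: Lb (m + n)
             + ((nu3 * delta0 m + (gamma * theta - gamma ^+ 2) / beta)
                  * qint q (m - n)) *: Wb (m + n),
           br (Lb m) (Wb n) =
             ((nu1 * delta0 m + gamma) * qint q (m - n)) *: Wb (m + n),
           br (Wb m) (Lb n) =
             ((nu2 * delta0 m + beta) * qint q (m - n)) *: Lb (m + n)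
             + ((nu4 * delta0 m + theta - gamma) * qint q (m - n)) *: Wb (m + n)
         & br (Wb m) (Wb n) =
             ((nu2 * delta0 m + beta) * qint q (m - n)) *: Wb (m + n)])].
Proof.
by split=> P br [avP _]; apply: (derived_on_basis hq); exact: avP.
Qed.
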